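(* Let $W$ be a real finite dimensional Hilbert space with norm $\|\cdot\|_W$, and let $W_1,\dots,W_J$ be (nonzero) subspaces of $W$ with $W=\sum_{j=1}^JW_j$ (the sum is not assumed to be direct). Assume: (i) there is a constant $a>0$ such that for all $\{u_j\}\in\prod_{j=1}^JW_j$, $$a\,\Big\|\sum_{j=1}^Ju_j\Big\|_W^2\le\sum_{j=1}^J\|u_j\|_W^2;$$ (ii) there is a constant $b>0$ such that every $u\in W$ admits a decomposition $u=\sum_{j=1}^Ju_j$ with $u_j\in W_j$ and $$\sum_{j=1}^J\|u_j\|_W^2\le b\,\|u\|_W^2;$$ (iii) for each $j$, $\{\phi_{j,k}\}_{k=1}^{N_j}$ is a basis of $W_j$, where $N_j=\dim W_j$, and $0<\alpha_j\le\beta_j$ are the optimal constants such that $$\alpha_j\sum_kc_{j,k}^2\le\Big\|\sum_kc_{j,k}\phi_{j,k}\Big\|_W^2\le\beta_j\sum_kc_{j,k}^2\qquad\text{for all real coefficients }\{c_{j,k}\}_k.$$ Let $\mathcal{K}_j=\beta_j/\alpha_j$. Then the frame $\Phi=\{\phi_{j,k}\}_{1\le j\le J,\,1\le k\le N_j}$ of $W$ satisfies $$\mathcal{K}(\Phi)\le a^{-1}b\,\Big(\max_{1\le j\le J}\mathcal{K}_j\Big)\max_{1\le j,l\le J}\frac{\alpha_j}{\alpha_l}.$$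
   Context: A frame of a finite dimensional real Hilbert space $W$ is a finite family $\Phi=\{\phi_k\}$ of elements spanning $W$ (not necessarily linearly independent). Its condition number is $\mathcal{K}(\Phi)=\beta/\alpha$, where $$\alpha=\inf_{0\ne u\in W}\frac{\|u\|_W^2}{\inf_{c:\,u=\sum_kc_k\phi_k}\|c\|_{\ell^2}^2},\qquad\beta=\sup_{0\ne u\in W}\frac{\|u\|_W^2}{\inf_{c:\,u=\sum_kc_k\phi_k}\|c\|_{\ell^2}^2},$$ and the inner infima are over all real coefficient vectors $c$ representing $u$. *)

(* Defs.v *)
From mathcomp Require Import all_boot all_order all_algebra.
From mathcomp Require Import sesquilinear.
From mathcomp Require Import all_classical all_reals ereal.

Set Implicit Arguments.
Unset Strict Implicit.
Unset Printing Implicit Defensive.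

Import Order.TTheory GRing.Theory Num.Theory.

Local Open Scope ring_scope.
Local Open Scope classical_set_scope.

(* A finite dimensional real Hilbert space is a [W : vectType R], with
   [R : realType], together with an inner product [dot : {dot W for idfun}]. *)

Definition hilbert_norm (R : realType) (W : vectType R)
  (dot : {dot W for idfun}) (u : W) : R := Num.sqrt (dot u u).

Section Families.
Variables (R : realType) (W : vectType R) (dot : {dot W for idfun}).
Variables (I : finType) (Phi : I -> W).

Definition synthesis (c : I -> R) : W := \sum_k c k *: Phi k.

Definition coef_sqnorm (c : I -> R) : R := \sum_k c k ^+ 2.

Definition is_frame : Prop := (<<codom Phi>> = fullv)%VS.

(* Extended real bounds are used so that infima and suprema never take default
   values: the infimum over an empty set of representations is [+oo], and an
   unbounded supremum is [+oo]. *)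

Definition min_coef_sqnorm (u : W) : \bar R :=
  ereal_inf [set (coef_sqnorm c)%:E | c in [set c | u = synthesis c]].

Definition frame_ratio (u : W) : \bar R :=
  ((hilbert_norm dot u ^+ 2)%:E / min_coef_sqnorm u)%E.

Definition frame_lower : \bar R :=
  ereal_inf [set frame_ratio u | u in [set u | u != 0]].

Definition frame_upper : \bar R :=
  ereal_sup [set frame_ratio u | u in [set u | u != 0]].

Definition condition_number : \bar R := (frame_upper / frame_lower)%E.

Definition riesz_lower (alpha : R) : Prop :=
  forall c : I -> R,
    alpha * coef_sqnorm c <= hilbert_norm dot (synthesis c) ^+ 2.

Definition riesz_upper (beta : R) : Prop :=
  forall c : I -> R,
    hilbert_norm dot (synthesis c) ^+ 2 <= beta * coef_sqnorm c.

Definition optimal_riesz_bounds (alpha beta : R) : Prop :=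
  [/\ riesz_lower alpha,
      forall alpha', riesz_lower alpha' -> alpha' <= alpha,
      riesz_upper beta
    & forall beta', riesz_upper beta' -> beta <= beta'].

End Families.

Definition union_family (R : realType) (W : vectType R) (J : nat)
  (N : 'I_J -> nat) (phi : forall j, (N j).-tuple W)
  (p : {j : 'I_J & 'I_(N j)}) : W := tnth (phi (tag p)) (tagged p).

(* Main.v *)
(* If [A |c|^2 <= ||u||^2] for some representation [c] of each [u], and
   [||u||^2 <= B |c|^2] for every representation, then the condition number is
   at most [B / A]. Summing the Riesz bounds of the blocks, (ii) provides
   [A = min_j alpha_j / b] and (i) provides [B = a^-1 max_j beta_j], where
   [max_j beta_j <= (max_j beta_j / alpha_j) (max_j alpha_j)]. *)
Require Import Defs.
From mathcomp Require Import all_boot all_order all_algebra.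
From mathcomp Require Import sesquilinear.
From mathcomp Require Import all_classical all_reals ereal.

Set Implicit Arguments.
Unset Strict Implicit.
Unset Printing Implicit Defensive.

Import Order.TTheory GRing.Theory Num.Theory.

Local Open Scope ring_scope.

Lemma hilbert_norm_gt0 (R : realType) (W : vectType R)
  (dot : {dot W for idfun}) (u : W) : u != 0 -> 0 < hilbert_norm dot u.
Proof. by move=> u0; rewrite sqrtr_gt0 neq0_dnorm_gt0. Qed.

Lemma coef_sqnorm_ge0 (R : realType) (I : finType) (c : I -> R) :
  0 <= coef_sqnorm c.
Proof. by apply: sumr_ge0 => k _; apply: sqr_ge0. Qed.

Section ConditionNumber.
Variables (R : realType) (W : vectType R) (dot : {dot W for idfun}).
Variables (I : finType) (Phi : I -> W).

Lemma is_frame_synthesis :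
  (forall u, exists c, u = synthesis Phi c) -> is_frame Phi.
Proof.
move=> surj; apply/vspaceP => u; rewrite memvf.
have [c ->] := surj u.
by apply: memv_suml => k _; rewrite memvZ // memv_span // codom_f.
Qed.

(** With [n] the squared norm of [u], the given [c] bounds the infimum of [coef_sqnorm] by [n / A]
    from above, and [upper], applied to every representation, bounds it by [n / B] from below. The
    infimum is thus finite and positive, so the extended quotient is an ordinary real one. *)
Lemma frame_ratio_bounds (A B : R) (u : W) : 0 < A ->
  (exists2 c, u = synthesis Phi c &
    A * coef_sqnorm c <= hilbert_norm dot u ^+ 2) ->
  riesz_upper dot Phi B -> u != 0 ->
  exists2 r : R, frame_ratio dot Phi u = r%:E & A <= r <= B.
Proof.
move=> A_gt0 [c uc Ac] upper u0; have n0 : 0 < hilbert_norm dot u ^+ 2.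
  by rewrite exprn_gt0 // hilbert_norm_gt0.
set n := hilbert_norm dot u ^+ 2 in Ac n0 *.
(* The sign of [B] is forced by [u != 0]: a positive norm is at most [B] times a nonnegative
   number. *)
have B_gt0 : 0 < B.
  have: 0 < B * coef_sqnorm c.
    by apply: lt_le_trans (upper c); rewrite -uc.
  by apply: contraTlt => B_le0; rewrite -leNgt mulr_le0_ge0 ?coef_sqnorm_ge0.
have m_le : (min_coef_sqnorm Phi u <= (n / A)%:E)%E.
  apply: (@le_trans _ _ (coef_sqnorm c)%:E).
    by apply: ereal_inf_lbound; exists c.
  by rewrite lee_fin ler_pdivlMr // mulrC.
have m_ge : ((n / B)%:E <= min_coef_sqnorm Phi u)%E.
  apply/ereal_infP => _ [d ud <-]; rewrite lee_fin ler_pdivrMr // mulrC.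
  by rewrite /n [u in hilbert_norm dot u]ud.
have m_fin : min_coef_sqnorm Phi u \is a fin_num.
  by rewrite fin_numE; case: min_coef_sqnorm m_le m_ge.
rewrite /frame_ratio -/n; move: m_fin m_le m_ge.
case: min_coef_sqnorm => // m _; rewrite !lee_fin => m_le m_ge.
have m0 : 0 < m by apply: lt_le_trans m_ge; rewrite divr_gt0.
(* The extended inverse of a real is the real inverse only away from [0], hence [m0]. *)
exists (n / m); first by rewrite inver gt_eqF // EFinM.
rewrite ler_pdivlMr // ler_pdivrMr // mulrC -ler_pdivlMr // m_le /=.
by rewrite mulrC -ler_pdivrMr.
Qed.

(** All ratios lie in [[A, B]]. The nonzero [w] supplies one ratio [r]; without any, the infimum
    would be [+oo] and the supremum [-oo]. Being squeezed between [A], [r] and [B], both bounds are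
    real. *)
Lemma condition_number_le (A B : R) : 0 < A ->
  (forall u, exists2 c, u = synthesis Phi c &
    A * coef_sqnorm c <= hilbert_norm dot u ^+ 2) ->
  riesz_upper dot Phi B -> (exists w : W, w != 0) ->
  (condition_number dot Phi <= (B / A)%:E)%E.
Proof.
move=> A_gt0 lower upper [w w0].
have ratio u := frame_ratio_bounds A_gt0 (lower u) upper.
have [r rw /andP[Ar rB]] := ratio w w0.
have lo : (A%:E <= frame_lower dot Phi)%E.
  apply/ereal_infP => _ [u /ratio[s -> /andP[As _]] <-].
  by rewrite lee_fin.
have lo' : (frame_lower dot Phi <= r%:E)%E.
  by rewrite -rw; apply: ereal_inf_lbound; exists w.
have up : (frame_upper dot Phi <= B%:E)%E.
  apply: ge_ereal_sup => _ [u /ratio[s -> /andP[_ sB]] <-].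
  by rewrite lee_fin.
have up' : (r%:E <= frame_upper dot Phi)%E.
  by rewrite -rw; apply: ereal_sup_ubound; exists w.
rewrite /condition_number; move: lo lo' up up'.
case: frame_lower => // l; case: frame_upper => // v; rewrite !lee_fin.
move=> Al _ vB rv; have l0 : 0 < l by apply: lt_le_trans Al.
rewrite inver gt_eqF // -EFinM lee_fin; apply: ler_pM => //.
- by apply: le_trans rv; apply: le_trans (ltW A_gt0) Ar.
- by rewrite invr_ge0 ltW.
- by rewrite lef_pV2.
Qed.

End ConditionNumber.

Section UnionFamily.
Variables (R : realType) (W : vectType R) (J : nat) (N : 'I_J -> nat).
Variable phi : forall j, (N j).-tuple W.
Implicit Type c : {j : 'I_J & 'I_(N j)} -> R.

Lemma synthesis_union c : synthesis (union_family phi) c =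
  \sum_j synthesis (tnth (phi j)) (fun k => c (Tagged (fun i => 'I_(N i)) k)).
Proof.
by rewrite sig_big_dep; apply: eq_bigr => -[j k].
Qed.

Lemma coef_sqnorm_union c :
  coef_sqnorm c =
  \sum_j coef_sqnorm (fun k : 'I_(N j) => c (Tagged (fun i => 'I_(N i)) k)).
Proof.
by rewrite sig_big_dep; apply: eq_bigr => -[j k].
Qed.

End UnionFamily.

Lemma synthesis_basis (R : realType) (W : vectType R) (n : nat)
  (X : n.-tuple W) (U : {vspace W}) (u : W) : basis_of U X -> u \in U ->
  u = synthesis (tnth X) (coord X ^~ u).
Proof.
move=> XU uU; rewrite {1}(coord_basis XU uU).
by apply: eq_bigr => k _; rewrite (tnth_nth 0).
Qed.

Theorem theorem3p1 (R : realType) (W : vectType R) (dot : {dot W for idfun})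
  (J : nat) (Ws : 'I_J -> {vspace W}) (a b : R)
  (phi : forall j : 'I_J, (\dim (Ws j)).-tuple W) (alpha beta : 'I_J -> R)
  (J_gt0 : (0 < J)%N)
  (Ws_neq0 : forall j, Ws j != 0%VS)
  (Ws_sum : (\sum_j Ws j)%VS = fullv)
  (a_gt0 : 0 < a)
  (stable_sum : forall u : 'I_J -> W, (forall j, u j \in Ws j) ->
    a * hilbert_norm dot (\sum_j u j) ^+ 2
      <= \sum_j hilbert_norm dot (u j) ^+ 2)
  (b_gt0 : 0 < b)
  (stable_decomposition : forall u : W, exists v : 'I_J -> W,
    [/\ forall j, v j \in Ws j,
        u = \sum_j v j
      & \sum_j hilbert_norm dot (v j) ^+ 2 <= b * hilbert_norm dot u ^+ 2])
  (phi_basis : forall j, basis_of (Ws j) (phi j))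
  (alpha_gt0 : forall j, 0 < alpha j)
  (alpha_le_beta : forall j, alpha j <= beta j)
  (alpha_beta_optimal : forall j,
    optimal_riesz_bounds dot (tnth (phi j)) (alpha j) (beta j)) :
  is_frame (union_family phi) /\
  (condition_number dot (union_family phi) <=
    (a^-1 * b * (\big[Num.max/0]_(j < J) (beta j / alpha j))
      * (\big[Num.max/0]_(p : 'I_J * 'I_J) (alpha p.1 / alpha p.2)))%:E)%E.
Proof.
pose j0 := Ordinal J_gt0.
(* Indices [l] and [m] attain the least and the greatest [alpha]; the pair [(m, l)] is the one
   compared with [Q] at the end. *)
case: (@arg_minP _ _ _ j0 predT alpha isT) => l _ alpha_min.
case: (@arg_maxP _ _ _ j0 predT alpha isT) => m _ alpha_max.
set K := \big[Num.max/0]_(j < J) _; set Q := \big[Num.max/0]_p _.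
have K_ge0 : 0 <= K by apply: bigmax_ge_id.
have beta_le j : beta j <= K * alpha m.
  rewrite (@le_trans _ _ (K * alpha j)) ?ler_wpM2l //; last exact: alpha_max.
  rewrite -ler_pdivrMr //; exact: (le_bigmax _ (fun j => beta j / alpha j)).
have lower u : exists2 c, u = synthesis (union_family phi) c &
    alpha l / b * coef_sqnorm c <= hilbert_norm dot u ^+ 2.
  have [v [vW uv vb]] := stable_decomposition u.
  (* The representation joins the coordinates of each piece [v j] of the stable decomposition in its
     own basis [phi j]. *)
  exists (fun p => coord (phi (tag p)) (tagged p) (v (tag p))).
    rewrite {1}uv synthesis_union; apply: eq_bigr => j _ /=.
    exact: synthesis_basis (phi_basis j) (vW j).
  rewrite mulrAC ler_pdivrMr // [leRHS]mulrC.
  apply: le_trans vb; rewrite coef_sqnorm_union mulr_sumr.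
  apply: ler_sum => j _ /=.
  have [riesz _ _ _] := alpha_beta_optimal j.
  rewrite [v j in leRHS](synthesis_basis (phi_basis j) (vW j)).
  apply: le_trans (riesz _).
  by rewrite ler_wpM2r ?coef_sqnorm_ge0 ?alpha_min.
split.
  by apply: is_frame_synthesis => u; have [c] := lower u; exists c.
have upper : riesz_upper dot (union_family phi) (a^-1 * (K * alpha m)).
  move=> c; rewrite synthesis_union -mulrA ler_pdivlMl //.
  (* For arbitrary coefficients, each block synthesizes a vector of [Ws i], so [stable_sum] applies
     to the blocks. *)
  apply: le_trans (stable_sum _ _) _ => [i|].
    apply: memv_suml => k _; rewrite memvZ //.
    by rewrite (basis_mem (phi_basis i)) // mem_tnth.
  rewrite coef_sqnorm_union mulr_sumr; apply: ler_sum => j _.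
  have [_ _ riesz _] := alpha_beta_optimal j.
  by rewrite (le_trans (riesz _)) // ler_wpM2r ?coef_sqnorm_ge0.
have W_neq0 : exists w : W, w != 0 by exists (vpick (Ws j0)); rewrite vpick0.
apply: le_trans (condition_number_le _ lower upper W_neq0) _.
  by rewrite divr_gt0.
(* The quotient of the two constants is exactly [a^-1 * b * K * (alpha m / alpha l)], and its last
   factor is one of the terms of the maximum [Q]. *)
rewrite lee_fin invf_div.
have -> : a^-1 * (K * alpha m) * (b / alpha l) =
    a^-1 * b * K * (alpha m / alpha l).
  by rewrite mulrACA !mulrA.
apply: ler_wpM2l; first by rewrite !mulr_ge0 // ?invr_ge0 ltW.
exact: (le_bigmax _ (fun p : 'I_J * 'I_J => alpha p.1 / alpha p.2) (m, l)).
Qed.
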